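(* Let $a,b,c,d\in\mathbb{C}$ be such that $|a|^2+|b|^2=|c|^2+|d|^2=1$ and let \[ \begin{aligned} w ={}& S_1(aS_1S_1^*+bS_1S_2^* )S_1^*+S_1(cS_2S_1^*+dS_2S_2^* )S_2^*\\ &+S_2(-\overline{b}S_1S_1^*+\overline{a}S_1S_2^* )S_1^*+S_2(-\overline{d}S_2S_1^*+\overline{c}S_2S_2^* )S_2^*\in\mathcal{O}_2 . \end{aligned} \] Then $w$ is a unitary in $\mathcal{F}_2^2$ satisfying $w\mathcal{D}_2^1w^*=\varphi(\mathcal{D}_2^1)$, and thus $\lambda_w(\mathcal{D}_2)\subseteq\mathcal{D}_2$, but $w$ belongs to $\mathcal{N}_{\mathcal{O}_2}(\mathcal{D}_2)$ only if $ab=cd=0$.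
   Context: $\mathcal{O}_2$ is the Cuntz algebra generated by isometries $S_1,S_2$ with $S_1S_1^*+S_2S_2^*=I$. For a word $\alpha=(\alpha_1,\ldots,\alpha_k)\in\{1,2\}^k$ put $S_\alpha=S_{\alpha_1}\cdots S_{\alpha_k}$. $\mathcal{F}_2^k$ is the span of $S_\alpha S_\beta^*$ with $\alpha,\beta\in\{1,2\}^k$; $\mathcal{D}_2$ is the $C^*$-subalgebra generated by all projections $S_\alpha S_\alpha^*$ over all words $\alpha$, and $\mathcal{D}_2^1=\mathcal{D}_2\cap\mathcal{F}_2^1$. The canonical shift is $\varphi(x)=S_1xS_1^*+S_2xS_2^*$. For a unitary $w\in\mathcal{O}_2$, $\lambda_w$ is the unital $*$-endomorphism of $\mathcal{O}_2$ determined by $\lambda_w(S_i)=wS_i$, $i=1,2$. The normalizer is $\mathcal{N}_{\mathcal{O}_2}(\mathcal{D}_2)=\{u\in\mathcal{O}_2\text{ unitary}: u\mathcal{D}_2u^*=\mathcal{D}_2\}$. *)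

(* Defs.v *)
(* Mathematical Components and MathComp-Analysis; the complex numbers are R[i]
   for R : realType. *)
From HB Require Import structures.
From mathcomp Require Import all_boot all_order all_algebra.
From mathcomp Require Import complex.
From mathcomp Require Import all_classical all_reals all_analysis.

Set Implicit Arguments.
Unset Strict Implicit.
Unset Printing Implicit Defensive.

Import Order.TTheory GRing.Theory Num.Theory.
Import numFieldNormedType.Exports.

Local Open Scope classical_set_scope.
Local Open Scope ring_scope.

(* As everywhere in numFieldType-normed modules, the norm takes its values in
   the scalars C themselves (in the nonnegative reals of C). The product is a
   field of the mixin instead of being inherited from GRing.Algebra because
   Hierarchy Builder cannot declare a second structure, next to Num.NumDomain,
   lying below both the rings and the normed groups; the GRing.Algebra instance
   is attached to every C*-algebra just below. *)
HB.mixin Record CompleteNormedModule_isCStar (C : numClosedFieldType) A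
    of CompleteNormedModule C A := {
  cstar_mul : A -> A -> A ;
  cstar_one : A ;
  star : A -> A ;
  cstar_mulA : associative cstar_mul ;
  cstar_mul1x : left_id cstar_one cstar_mul ;
  cstar_mulx1 : right_id cstar_one cstar_mul ;
  cstar_mulDl : left_distributive cstar_mul +%R ;
  cstar_mulDr : right_distributive cstar_mul +%R ;
  cstar_one_neq0 : cstar_one != 0 ;
  cstar_scaleAl : forall (k : C) (x y : A),
    k *: cstar_mul x y = cstar_mul (k *: x) y ;
  cstar_scaleAr : forall (k : C) (x y : A),
    k *: cstar_mul x y = cstar_mul x (k *: y) ;
  starD : {morph star : x y / x + y} ;
  starZ : forall (k : C) (x : A), star (k *: x) = k^* *: star x ;
  star_mul : forall x y : A,
    star (cstar_mul x y) = cstar_mul (star y) (star x) ;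
  starK : involutive star ;
  cstar_norm_mul_le : forall x y : A, `|cstar_mul x y| <= `|x| * `|y| ;
  cstar_norm_star_mul : forall x : A, `|cstar_mul (star x) x| = `|x| ^+ 2
}.

(* Nonzero unital C*-algebras. *)
#[short(type="cstarAlgType")]
HB.structure Definition CStarAlgebra (C : numClosedFieldType) :=
  {A of CompleteNormedModule C A & CompleteNormedModule_isCStar C A}.

#[non_forgetful_inheritance]
HB.instance Definition _ (C : numClosedFieldType) (A : cstarAlgType C) :=
  GRing.Zmodule_isNzRing.Build (CStarAlgebra.sort A)
    (@cstar_mulA C A) (@cstar_mul1x C A) (@cstar_mulx1 C A)
    (@cstar_mulDl C A) (@cstar_mulDr C A) (@cstar_one_neq0 C A).
#[non_forgetful_inheritance]
HB.instance Definition _ (C : numClosedFieldType) (A : cstarAlgType C) :=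
  GRing.Lmodule_isLalgebra.Build C (CStarAlgebra.sort A) (@cstar_scaleAl C A).
#[non_forgetful_inheritance]
HB.instance Definition _ (C : numClosedFieldType) (A : cstarAlgType C) :=
  GRing.Lalgebra_isAlgebra.Build C (CStarAlgebra.sort A) (@cstar_scaleAr C A).

Section CStar.
Context {C : numClosedFieldType}.

(* Not assumed continuous: contractivity is automatic. *)
Definition unital_star_hom (A B : cstarAlgType C) (f : A -> B) : Prop :=
  [/\ linear f, monoid_morphism f & forall x, f (star x) = star (f x)].

Definition unitary (A : cstarAlgType C) (u : A) : Prop :=
  star u * u = 1 /\ u * star u = 1.

(* Not required to contain 1. *)
Definition cstar_subalgebra (A : cstarAlgType C) (M : set A) : Prop :=
  [/\ closed M, M 0,
      (forall (k : C) x y, M x -> M y -> M (k *: x + y)),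
      (forall x y, M x -> M y -> M (x * y))
    & (forall x, M x -> M (star x))].

Definition cstar_generated (A : cstarAlgType C) (G : set A) : set A :=
  smallest (@cstar_subalgebra A) G.

(* u M u^* *)
Definition conj_by (A : cstarAlgType C) (u : A) (M : set A) : set A :=
  [set u * x * star u | x in M].

Definition normalizer (A : cstarAlgType C) (M : set A) : set A :=
  [set u | unitary u /\ conj_by u M = M].

(* The generators S_1, S_2 are S ord0, S ord_max for S : 'I_2 -> A. *)
Definition cuntz_relations (A : cstarAlgType C) (S : 'I_2 -> A) : Prop :=
  (forall i, star (S i) * S i = 1) /\ \sum_i S i * star (S i) = 1.

(* A is the Cuntz algebra O_2 with canonical generators S: the universal unital
   C*-algebra generated by two isometries subject to the Cuntz relation.
   Universality is what provides the endomorphisms lambda_w. *)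
Definition is_cuntz_algebra (A : cstarAlgType C) (S : 'I_2 -> A) : Prop :=
  [/\ cuntz_relations S,
      cstar_generated (range S) = [set: A]
    & forall (B : cstarAlgType C) (T : 'I_2 -> B), cuntz_relations T ->
        exists2 f : A -> B, unital_star_hom f & forall i, f (S i) = T i].

Section CuntzObjects.
Variables (A : cstarAlgType C) (S : 'I_2 -> A).

Definition word_isom (alpha : seq 'I_2) : A := \prod_(i <- alpha) S i.

Definition F2 (k : nat) : set A :=
  [set x | exists c : k.-tuple 'I_2 -> k.-tuple 'I_2 -> C,
     x = \sum_alpha \sum_beta
           c alpha beta *: (word_isom alpha * star (word_isom beta))].

Definition D2 : set A :=
  cstar_generated
    [set word_isom alpha * star (word_isom alpha) | alpha in [set: seq 'I_2]].

Definition D2_level (k : nat) : set A := D2 `&` F2 k.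

Definition canonical_shift (x : A) : A := \sum_i S i * x * star (S i).

(* lam = lambda_w *)
Definition is_cuntz_endo (w : A) (lam : A -> A) : Prop :=
  unital_star_hom lam /\ forall i, lam (S i) = w * S i.

End CuntzObjects.
End CStar.

(* Main.v *)
Require Import Defs.
From mathcomp Require Import all_boot all_order all_algebra.
From mathcomp Require Import complex.
From mathcomp Require Import all_classical all_reals all_analysis.
From mathcomp Require Import ring.

(** The words of length two are orthonormal, and in this basis w is block
    diagonal with unitary 2 x 2 blocks up to reordering, which gives unitarity.
    The key identity is w S_i phi(x) S_i^* w^* = phi (S_i x S_i^* ): by induction
    on words it shows that lambda_w agrees with phi on the range projections of
    words, and for x = 1 it is w D_2^1 w^* = phi (D_2^1). Continuity of
    *-homomorphisms, needed to pass to closures, is obtained by writing a small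
    self-adjoint element as the real part of a unitary. Finally, elements of D_2
    commute with the range projections, so they have no off-diagonal matrix
    coefficients between orthogonal words; for w P_11 w^* and w P_21 w^* these
    coefficients are, up to sign and conjugation, ab and cd. *)

Set Implicit Arguments.
Unset Strict Implicit.
Unset Printing Implicit Defensive.

Import Order.TTheory GRing.Theory Num.Theory.
Import numFieldNormedType.Exports.

Local Open Scope classical_set_scope.
Local Open Scope ring_scope.

(** * Lipschitz maps and closed equalizers in normed spaces *)

Section Lipschitz.
Context {K : numFieldType} {V W : normedModType K}.

Lemma lipschitz_continuous (f : V -> W) (k : K) :
  (forall x y, `|f x - f y| <= k * `|x - y|) -> continuous f.
Proof.
move=> fk x.
(* Adding 1 keeps the divisor positive even when k = 0. *)
have k0 : 0 < `|k| + 1 by rewrite ltr_wpDl.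
apply/cvgrPdist_lt => e e0; near=> z.
have [xz|xz] := eqVneq x z; first by rewrite xz subrr normr0.
have n0 : 0 < `|x - z| by rewrite normr_gt0 subr_eq0.
have kr : k \is Num.real.
  have : 0 <= k * `|x - z| by apply: le_trans (fk x z).
  by rewrite pmulr_lge0// => /ger0_real.
apply: (@le_lt_trans _ _ ((`|k| + 1) * `|x - z|)).
  apply: (le_trans (fk x z)); rewrite ler_pM2r//.
  by apply: (le_trans (real_ler_norm kr)); rewrite lerDl.
rewrite -ltr_pdivlMl//.
by near: z; apply: cvgr_dist_lt => //; rewrite mulrC divr_gt0.
Unshelve. all: by end_near. Qed.

Lemma closed_eq_fun (f g : V -> W) :
  continuous f -> continuous g -> closed [set x | f x = g x].
Proof.
move=> fc gc.
have -> : [set x | f x = g x] = (fun x => f x - g x) @^-1` [set 0].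
  apply/seteqP; split=> x /=; first by move->; rewrite subrr.
  by move/eqP; rewrite subr_eq0 => /eqP.
apply: (@preimage_closed _ _ (fun x => f x - g x)).
- by move=> x _; apply: cvgB; [exact: fc | exact: gc].
- by apply: accessible_closed_set1; apply: hausdorff_accessible; exact: norm_hausdorff.
Qed.

End Lipschitz.

(** * Norm and involution in a C*-algebra *)

Section CStarBasics.
Context {C : numClosedFieldType}.
Implicit Types A B : cstarAlgType C.

Lemma starM A (x y : A) : star (x * y) = star y * star x.
Proof. exact: star_mul. Qed.

Lemma normM_le A (x y : A) : `|x * y| <= `|x| * `|y|.
Proof. exact: cstar_norm_mul_le. Qed.

Lemma norm_starM A (x : A) : `|star x * x| = `|x| ^+ 2.
Proof. exact: cstar_norm_star_mul. Qed.

Lemma star0 A : star (0 : A) = 0.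
Proof. by apply: (addrI (star 0)); rewrite -starD !addr0. Qed.

Lemma starN A (x : A) : star (- x) = - star x.
Proof. by apply: (addrI (star x)); rewrite -starD !subrr star0. Qed.

Lemma starB A (x y : A) : star (x - y) = star x - star y.
Proof. by rewrite starD starN. Qed.

Lemma star1 A : star (1 : A) = 1.
Proof. by rewrite -[star 1]mulr1 -[X in _ * X]starK -starM mulr1 starK. Qed.

(** The C*-identity gives |y|^2 = |y^* y| <= |y^*| |y|; cancelling |y| yields one inequality, and
    [starK] the other. *)
Lemma norm_star A (x : A) : `|star x| = `|x|.
Proof.
suff le (y : A) : `|y| <= `|star y| :> C by apply/le_anti; rewrite le -[X in _ <= `|X|]starK le.
have [->|y0] := eqVneq y 0; first by rewrite star0 normr0.
have n0 : 0 < `|y| by rewrite normr_gt0.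
by rewrite -(ler_pM2r n0) -expr2 -norm_starM normM_le.
Qed.

Lemma norm_unitary A (u : A) : unitary u -> `|u| = 1.
Proof.
have n1 : `|1 : A| = 1.
  have n0 : `|1 : A| != 0 by rewrite normr_eq0 oner_neq0.
  by apply: (mulfI n0); rewrite -expr2 -norm_starM star1 !mulr1.
case=> uu _; apply/eqP.
by rewrite -(@eqrXn2 _ 2) ?ler01// -norm_starM uu n1 expr1n.
Qed.

Lemma star_continuous A : continuous (@star C A).
Proof.
apply: (@lipschitz_continuous _ _ _ _ 1) => x y.
by rewrite -starB norm_star mul1r.
Qed.

Lemma mull_continuous A (x : A) : continuous (fun y : A => x * y).
Proof.
apply: (@lipschitz_continuous _ _ _ _ `|x|) => y z.
by rewrite -mulrBr normM_le.
Qed.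

Lemma mulr_continuous A (x : A) : continuous (fun y : A => y * x).
Proof.
apply: (@lipschitz_continuous _ _ _ _ `|x|) => y z.
by rewrite -mulrBl mulrC normM_le.
Qed.

End CStarBasics.

(** * Automatic continuity of unital *-homomorphisms *)

Section BoundedHom.
Context {R : realType}.
Notation C := R[i].

(** A positive element of R[i] is real, so the Archimedean property of R applies, together with n <
    2^n. *)
Lemma exists_half_pow_lt (e : C) : 0 < e -> exists n, 2^-1 ^+ n < e.
Proof.
move=> e0; have er : e = (complex.Re e)%:C%C.
  by rewrite RRe_real// gtr0_real.
have x0 : 0 < complex.Re e by move: e0; rewrite {1}er -[0]/(0%:C%C) ltcR.
set x := complex.Re e in er x0.
exists (Num.bound x^-1).
have -> : 2^-1 ^+ Num.bound x^-1 = (2^-1 ^+ Num.bound x^-1)%:C%C :> C.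
  by rewrite rmorphXn/= fmorphV/= rmorph_nat.
rewrite er ltcR exprVn invf_plt ?posrE ?exprn_gt0//.
apply: (@lt_le_trans _ _ (Num.bound x^-1)%:R).
  by apply: archi_boundP; rewrite invr_ge0 ltW.
by rewrite -natrX ler_nat ltnW// ltn_expl.
Qed.

Lemma cvg_half_pow (V : completeNormedModType C) (u : nat -> V) :
  (forall n, `|u n.+1 - u n| <= 2^-1 ^+ n) -> cvgn u.
Proof.
move=> hu.
(* The right-hand side is the exact geometric sum; keeping the factor 1 - 2^-m lets the induction
   close. *)
have bd n m : `|u (n + m)%N - u n| <= 2 * 2^-1 ^+ n * (1 - 2^-1 ^+ m).
  elim: m => [|m IH]; first by rewrite addn0 expr0 !subrr normr0 mulr0.
  rewrite addnS -(subrK (u (n + m)%N) (u (n + m).+1)) -addrA.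
  apply: (le_trans (ler_normD _ _)); apply: (le_trans (lerD (hu _) IH)).
  rewrite exprD exprS le_eqVlt; apply/orP; left; apply/eqP.
  have -> : 1 - 2^-1 * 2^-1 ^+ m = (1 - 2^-1 ^+ m) + 2^-1 * 2^-1 ^+ m :> C.
    by field.
  by field.
apply/cauchy_cvgP/cauchy_exP => e e0.
have [n hn] : exists n, 2^-1 ^+ n < e / 2.
  by apply: exists_half_pow_lt; rewrite divr_gt0.
exists (u n); exists n => // m /= nm.
rewrite -ball_normE/= distrC -(subnKC nm).
apply: (le_lt_trans (bd _ _)); rewrite mulrC.
rewrite ltr_pdivlMr// mulrC in hn; apply: le_lt_trans hn.
by rewrite -[leRHS]mul1r ler_wpM2r ?mulr_ge0 ?exprn_ge0 ?invr_ge0//.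
Qed.

(** On the ball of radius 1/2 the map z |-> (k + z^2)/2 is a 1/2-contraction into itself, so its
    iterates from 0 converge. The closed set [M] carries properties of the iterates over to the
    limit. *)
Lemma halved_square_fixpoint (A : cstarAlgType C) (k : A) (M : set A) :
  `|k| <= 2^-1 -> closed M -> M 0 ->
  (forall z, M z -> M (2^-1 *: (k + z * z))) ->
  exists2 z, M z & z = 2^-1 *: (k + z * z).
Proof.
move=> kle Mc M0 MS; pose g (z : A) := 2^-1 *: (k + z * z).
pose z n := iter n g 0.
have h0 : 0 <= 2^-1 :> C by rewrite invr_ge0.
have nh : `|2^-1| = 2^-1 :> C by rewrite ger0_norm.
have zle n : `|z n| <= 2^-1.
  elim: n => [|n IH]; first by rewrite normr0.
  rewrite /z iterS -/(z n) /g normrZ nh -[leRHS]mulr1 ler_wpM2l//.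
  apply: (le_trans (ler_normD _ _)).
  have -> : 1 = 2^-1 + 2^-1 :> C by field.
  apply: lerD => //; apply: (le_trans (normM_le _ _)).
  rewrite -[leRHS]mulr1 ler_pM//; apply: (le_trans IH).
  by rewrite invf_le1// ler1n.
have sqB (x y : A) : x * x - y * y = x * (x - y) + (x - y) * y.
  by rewrite mulrBr mulrBl addrA subrK.
have gB (x y : A) : `|g x - g y| <= 2^-1 * ((`|x| + `|y|) * `|x - y|).
  rewrite /g -scalerBr normrZ nh ler_wpM2l// opprD addrACA subrr add0r sqB.
  apply: (le_trans (ler_normD _ _)); rewrite [leRHS]mulrDl.
  by apply: lerD; apply: (le_trans (normM_le _ _)); rewrite // mulrC.
have dz n : `|z n.+1 - z n| <= 2^-1 ^+ n.
  elim: n => [|n IH].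
    rewrite expr0 subr0; apply: (le_trans (zle _)).
    by rewrite invf_le1// ler1n.
  rewrite exprS -[z n.+2]/(g (z n.+1)) -[X in _ - X]/(g (z n)).
  apply: (le_trans (gB _ _)); rewrite ler_wpM2l//; apply: le_trans IH.
  rewrite -[leRHS]mul1r ler_wpM2r//.
  have -> : 1 = 2^-1 + 2^-1 :> C by field.
  exact: lerD.
have cz := cvg_half_pow dz.
(* The Lipschitz bound on g grows with the arguments, so continuity is checked at the limit only,
   for x within distance 1 of it. *)
have gc : g @ limn z --> g (limn z).
  apply/cvgrPdist_lt => e e0; near=> x.
  apply: (le_lt_trans (gB _ _)).
  have K0 : 0 < 2^-1 * (`|limn z| + (`|limn z| + 1)) :> C.
    by rewrite mulr_gt0 ?invr_gt0// ltr_wpDl// ltr_wpDl.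
  apply: (@le_lt_trans _ _ (2^-1 * (`|limn z| + (`|limn z| + 1)) * `|limn z - x|)).
    rewrite mulrA ler_wpM2r// ler_wpM2l// lerD2l.
    rewrite -[X in `|X| <= _](subrK (limn z)) addrC.
    apply: (le_trans (ler_normD _ _)); rewrite lerD2l distrC.
    near: x; apply: cvgr_dist_le => //; exact: cvg_id.
  rewrite -ltr_pdivlMl//; near: x.
  by apply: cvgr_dist_lt; [exact: cvg_id | rewrite mulrC divr_gt0].
have gz : z n.+1 @[n --> \oo] --> g (limn z).
  exact: (cvg_comp _ _ cz gc).
exists (limn z).
  apply: (closed_cvg M) cz => //; apply: nearW => n.
  by elim: n => [//|n IH]; exact: MS.
have zS : z n.+1 @[n --> \oo] --> limn z by rewrite (cvg_shiftS z).
exact: (cvg_unique (@norm_hausdorff _ _) zS gz).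
Unshelve. all: by end_near. Qed.

(* h is the real part of the unitary h + i sqrt(1 - h^2); the square root is
   1 - z with z a fixed point of z |-> (h^2 + z^2) / 2. *)
Lemma selfadjoint_real_part_unitary (A : cstarAlgType C) (h : A) :
  star h = h -> `|h| <= 2^-1 -> exists2 u, unitary u & h + h = u + star u.
Proof.
move=> hs hle.
have h1 : 2^-1 <= 1 :> C by rewrite invf_le1// ler1n.
(* The fixed point is sought among self-adjoint elements commuting with h: unitarity of h + i y
   needs both properties for y = 1 - z. *)
have [||||z [zs zh] zE] := @halved_square_fixpoint A (h * h)
    ([set z | star z = z] `&` [set z | h * z = z * h]).
- apply: (le_trans (normM_le _ _)); rewrite -[leRHS]mulr1 ler_pM//.
  exact: le_trans h1.
- apply: closedI; apply: closed_eq_fun.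
  + exact: star_continuous.
  + by move=> x; exact: cvg_id.
  + exact: mull_continuous.
  + exact: mulr_continuous.
- by split; rewrite /= ?star0 ?mulr0 ?mul0r.
- move=> z [/= sz cz]; split.
    by rewrite /= starZ starD !starM hs sz fmorphV/= rmorph_nat.
  rewrite /= -scalerAr -scalerAl mulrDr mulrDl; congr (_ *: (_ + _)).
    by rewrite mulrA.
  by rewrite mulrA cz -mulrA cz mulrA.
pose y := 1 - z.
have ys : star y = y by rewrite starB star1 zs.
move: zs zh => /= zs zh.
have yh : h * y = y * h by rewrite /y mulrBr mulrBl mulr1 mul1r zh.
(* The fixed-point equation reads 2z = h^2 + z^2, which is (1 - z)^2 = 1 - h^2. *)
have yy : h * h + y * y = 1.
  have zz : z + z = h * h + z * z.
    by rewrite {1 2}zE -scalerDl -[2^-1]mul1r -splitr scale1r.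
  have -> : h * h = z + z - z * z by rewrite zz addrK.
  rewrite /y mulrBl mul1r mulrBr mulr1 opprB addrACA addKr.
  by rewrite [z + z + _]addrC addrA subrK addrK.
have ii : 'i * 'i = -1 :> C by rewrite -expr2 sqrCi.
exists (h + 'i *: y); last first.
  by rewrite starD hs starZ ys conjCi scaleNr addrACA subrr addr0.
have su : star (h + 'i *: y) = h - 'i *: y.
  by rewrite starD hs starZ ys conjCi scaleNr.
split; rewrite su.
  rewrite mulrDr !mulrDl !mulNr -!scalerAr -!scalerAl yh scalerA.
  by rewrite ii scaleN1r opprK addrA subrK.
rewrite mulrDl !mulrDr !mulrN -!scalerAr -!scalerAl yh scalerA.
by rewrite ii scaleN1r opprK addrA subrK.
Qed.

Section Hom.
Variables (A B : cstarAlgType C) (f : A -> B).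
Hypothesis hf : unital_star_hom f.

Let f1 : f 1 = 1. Proof. by case: hf => _ [-> _]. Qed.
Let fM x y : f (x * y) = f x * f y. Proof. by case: hf => _ [_ ->]. Qed.
Let fs x : f (star x) = star (f x). Proof. by case: hf. Qed.
Let fD x y : f (x + y) = f x + f y.
Proof. by case: hf => fl _ _; rewrite -[x in LHS]scale1r fl scale1r. Qed.
Let f0 : f 0 = 0.
Proof. by apply: (addrI (f 0)); rewrite -fD !addr0. Qed.
Let fZ k x : f (k *: x) = k *: f x.
Proof. by case: hf => fl _ _; rewrite -[k *: x]addr0 fl f0 addr0. Qed.
Let fB x y : f (x - y) = f x - f y.
Proof. by rewrite -scaleN1r fD fZ scaleN1r. Qed.

(** Rescaled to norm 1/2, h is half the sum of a unitary and its adjoint, and f sends unitaries to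
    unitaries, which have norm 1. The crude constant 2 suffices for continuity. *)
Lemma star_hom_norm_selfadjoint (h : A) : star h = h -> `|f h| <= 2 * `|h|.
Proof.
move=> hs; have [->|h0] := eqVneq h 0; first by rewrite f0 !normr0 mulr0.
have n0 : 0 < `|h| by rewrite normr_gt0.
pose t : C := (2 * `|h|)^-1.
have t0 : 0 < t by rewrite invr_gt0 mulr_gt0.
have nt : `|t| = t by rewrite gtr0_norm.
have [||u uu hu] := @selfadjoint_real_part_unitary A (t *: h).
- by rewrite starZ hs geC0_conj// ltW.
- by rewrite normrZ nt /t invfM mulfVK// gt_eqF.
have fu : unitary (f u) by case: uu => u1 u2; split; rewrite -fs -fM ?u1 ?u2 f1.
have : `|f (t *: h) + f (t *: h)| <= 1 + 1.
  rewrite -fD hu fD fs; apply: (le_trans (ler_normD _ _)).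
  by rewrite norm_star (norm_unitary fu).
rewrite -mulr2n normrMn -[1 + 1]/(1 *+ 2) ler_pMn2r// fZ normrZ nt.
by rewrite /t mulrC ler_pdivrMr ?mul1r// mulr_gt0.
Qed.

(** The C*-identity reduces a general v to the self-adjoint v^* v: |f v|^2 = |f (v^* v)| <= 2
    |v|^2. *)
Lemma star_hom_continuous : continuous f.
Proof.
apply: (@lipschitz_continuous _ _ _ _ 2) => x y; rewrite -fB.
set v := x - y.
have : `|f v| ^+ 2 <= (2 * `|v|) ^+ 2.
  rewrite -norm_starM -fs -fM.
  apply: (le_trans (star_hom_norm_selfadjoint _)).
    by rewrite starM starK.
  rewrite norm_starM exprMn ler_wpM2r ?exprn_ge0//.
  by rewrite expr2 ler_peMr// ler1n.
by rewrite ler_pXn2r ?nnegrE ?mulr_ge0.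
Qed.

End Hom.
End BoundedHom.

(** * Generated C*-subalgebras and commutants *)

Section Subalgebras.
Context {C : numClosedFieldType} (A : cstarAlgType C).

Lemma cstar_generated_subalgebra (G : set A) : cstar_subalgebra (cstar_generated G).
Proof.
split.
- by apply: closed_bigI => M [[]].
- by move=> M [[]].
- by move=> k x y hx hy M MG; case: (MG) => -[_ _ + _ _] _; apply; [exact: hx|exact: hy].
- by move=> x y hx hy M MG; case: (MG) => -[_ _ _ + _] _; apply; [exact: hx|exact: hy].
- by move=> x hx M MG; case: (MG) => -[_ _ _ _ +] _; apply; exact: hx.
Qed.

Lemma cstar_subalgebraD (M : set A) x y :
  cstar_subalgebra M -> M x -> M y -> M (x + y).
Proof. by case=> _ _ ML _ _ Mx My; rewrite -[x]scale1r; exact: ML. Qed.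

(** Stability under the involution comes from self-adjointness of [P], closedness from continuity of
    multiplication. *)
Lemma commutant_subalgebra (P : A) : star P = P ->
  cstar_subalgebra [set x : A | x * P = P * x].
Proof.
move=> Ps; split=> /=.
- by apply: closed_eq_fun; [exact: mulr_continuous | exact: mull_continuous].
- by rewrite mul0r mulr0.
- by move=> k x y xP yP; rewrite mulrDl mulrDr -scalerAl -scalerAr xP yP.
- by move=> x y xP yP; rewrite -mulrA yP mulrA xP mulrA.
- by move=> x xP; rewrite -[P in LHS]Ps -[P in RHS]Ps -!starM xP.
Qed.

End Subalgebras.

(** * Equalizers and preimages under *-homomorphisms *)

Section StarHomSubalgebras.
Context {R : realType} {A B : cstarAlgType R[i]}.
Implicit Types f g : A -> B.

(** Serves the uniqueness of lambda_w: agreement on generators spreads to the algebra they generate.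
    Closedness rests on automatic continuity. *)
Lemma equalizer_subalgebra f g : unital_star_hom f -> unital_star_hom g ->
  cstar_subalgebra [set x | f x = g x].
Proof.
move=> hf hg; have fc := star_hom_continuous hf; have gc := star_hom_continuous hg.
case: hf hg => [fl [_ fM] fs] [gl [_ gM] gs]; split=> /=.
- exact: closed_eq_fun.
- have l0 h : linear h -> h 0 = 0 :> B.
    by move=> hl; have := hl (-1) 0 0; rewrite scaler0 addr0 scaleN1r addNr.
  by rewrite !l0.
- by move=> k x y fx fy; rewrite fl gl fx fy.
- by move=> x y fx fy; rewrite fM gM fx fy.
- by move=> x fx; rewrite fs gs fx.
Qed.

(** Allows the invariance of D_2 under lambda_w to be tested on the generating projections. *)
Lemma preimage_subalgebra f (M : set B) : unital_star_hom f ->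
  cstar_subalgebra M -> cstar_subalgebra (f @^-1` M).
Proof.
move=> hf; have fc := star_hom_continuous hf.
case: hf => [fl [_ fM] fs] [Mc M0 ML MM Ms]; split=> /=.
- by apply: preimage_closed => // x _; exact: fc.
- by have := fl (-1) 0 0; rewrite scaler0 addr0 scaleN1r addNr => ->.
- by move=> k x y fx fy; rewrite fl; exact: ML.
- by move=> x y fx fy; rewrite fM; exact: MM.
- by move=> x fx; rewrite fs; exact: Ms.
Qed.

End StarHomSubalgebras.

(** * Cuntz relations, range projections of words, and the diagonal D_2 *)

Section Cuntz.
Context {C : numClosedFieldType} {A : cstarAlgType C} (S : 'I_2 -> A).
Hypothesis hS : cuntz_relations S.
Local Notation S1 := (S ord0).
Local Notation S2 := (S ord_max).

Lemma cuntz_isometry i : star (S i) * S i = 1. Proof. by case: hS. Qed.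

Lemma ord2_cases (i : 'I_2) : i = ord0 \/ i = ord_max.
Proof. by case: i => [[|[|//]] ?]; [left|right]; exact: val_inj. Qed.

Lemma sum_ord2 (V : zmodType) (F : 'I_2 -> V) : \sum_i F i = F ord0 + F ord_max.
Proof. by rewrite big_ord_recl big_ord1; congr (_ + F _); exact: val_inj. Qed.

Lemma cuntz_sum1 : S1 * star S1 + S2 * star S2 = 1.
Proof. by rewrite -(sum_ord2 (fun i => S i * star (S i))); case: hS. Qed.

(** Sandwiching S_1 S_1^* + S_2 S_2^* = 1 between S_1^* and S_2 gives s + s = s for s = S_1^*
    S_2. *)
Lemma cuntz_orth12 : star S1 * S2 = 0.
Proof.
have: star S1 * (S1 * star S1 + S2 * star S2) * S2 = star S1 * S2.
  by rewrite cuntz_sum1 mulr1.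
rewrite mulrDr mulrDl -!mulrA cuntz_isometry mulr1 mulrA cuntz_isometry mul1r.
by move=> /eqP; rewrite -subr_eq0 addrK => /eqP.
Qed.

Lemma cuntz_orth21 : star S2 * S1 = 0.
Proof. by rewrite -[S1]starK -starM cuntz_orth12 star0. Qed.

Lemma cuntz_cancel i (x : A) : star (S i) * (S i * x) = x.
Proof. by rewrite mulrA cuntz_isometry mul1r. Qed.

Lemma cuntz_cancel12 (x : A) : star S1 * (S2 * x) = 0.
Proof. by rewrite mulrA cuntz_orth12 mul0r. Qed.

Lemma cuntz_cancel21 (x : A) : star S2 * (S1 * x) = 0.
Proof. by rewrite mulrA cuntz_orth21 mul0r. Qed.

Definition cuntz_simp := (cuntz_isometry, cuntz_orth12, cuntz_orth21,
  cuntz_cancel, cuntz_cancel12, cuntz_cancel21).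

(** The range projections of the words of length two sum to 1, so these words act as a basis. *)
Lemma eq_on_words (x y : A) :
  (forall i j, x * (S i * S j) = y * (S i * S j)) -> x = y.
Proof.
move=> xy.
have e1 i : x * S i = y * S i.
  rewrite -[x * S i]mulr1 -[y * S i]mulr1 -cuntz_sum1 !mulrDr !mulrA.
  by rewrite -!(mulrA _ (S i)) !xy.
by rewrite -[x]mulr1 -[y]mulr1 -cuntz_sum1 !mulrDr !mulrA !e1.
Qed.

Lemma range_projection_selfadj (al : seq 'I_2) :
  star (word_isom S al * star (word_isom S al)) = word_isom S al * star (word_isom S al).
Proof. by rewrite starM starK. Qed.

Lemma word_isom_isometry (al : seq 'I_2) : star (word_isom S al) * word_isom S al = 1.
Proof.
elim: al => [|i al IH]; rewrite /word_isom ?big_nil ?star1 ?mulr1//.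
by rewrite big_cons starM -mulrA cuntz_cancel.
Qed.

Lemma range_projection_cons i (al : seq 'I_2) :
  word_isom S (i :: al) * star (word_isom S (i :: al)) =
  S i * (word_isom S al * star (word_isom S al)) * star (S i).
Proof. by rewrite /word_isom big_cons starM !mulrA. Qed.

Let pr al := word_isom S al * star (word_isom S al).

(** Induction on first letters: equal letters cancel and leave the tails, different letters make
    both products 0. *)
Lemma range_projections_commute (al be : seq 'I_2) : pr al * pr be = pr be * pr al.
Proof.
elim: al be => [|i al IH] [|j be]; rewrite /pr.
- by [].
- by rewrite /word_isom big_nil star1 !mulr1 mul1r.
- by rewrite /word_isom big_nil star1 !mulr1 mul1r.
rewrite !range_projection_cons; have := IH be; rewrite /pr.
move: (word_isom S al * _) (word_isom S be * _) => x y xy; rewrite -!mulrA.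
case: (ord2_cases i) => ->; case: (ord2_cases j) => ->;
  rewrite ?cuntz_cancel ?cuntz_cancel12 ?cuntz_cancel21 ?mulr0//;
  by rewrite (mulrA x) xy -mulrA.
Qed.

Lemma D2_commute al (x : A) : D2 S x -> x * pr al = pr al * x.
Proof.
have := commutant_subalgebra (range_projection_selfadj al).
move=> Ms Dx; apply: (Dx [set x | x * pr al = pr al * x]); split => //.
by move=> _ [be _ <-] /=; exact: range_projections_commute.
Qed.

(** Write S_al as [pr al] times S_al and move [pr al] to the left of x, where it meets S_be^* and
    vanishes. *)
Lemma D2_offdiag al be (x : A) : D2 S x ->
  star (word_isom S be) * word_isom S al = 0 ->
  star (word_isom S be) * x * word_isom S al = 0.
Proof.
move=> Dx orth.
have -> : word_isom S al = pr al * word_isom S al.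
  by rewrite -mulrA word_isom_isometry mulr1.
by rewrite -mulrA (mulrA x) (D2_commute _ Dx) !mulrA orth !mul0r.
Qed.

Lemma D2_range_projection al : D2 S (pr al).
Proof. by move=> M [_]; apply; exists al. Qed.

Lemma F2_word (k : nat) (al be : k.-tuple 'I_2) :
  F2 S k (word_isom S al * star (word_isom S be)).
Proof.
exists (fun x y => ((x == al) && (y == be))%:R).
rewrite (bigD1 al)//= (bigD1 be)//= !eqxx scale1r !big1 ?addr0//.
  by move=> i /negbTE->; rewrite big1// => j _; rewrite scale0r.
by move=> i /negbTE->; rewrite andbF scale0r.
Qed.

(** x is a combination of S_m S_n^* for single letters m, n, and each of S_i^* S_m and S_n^* S_j is
    0 or 1. *)
Lemma F21_compress (x : A) i j : F2 S 1 x -> exists k : C, star (S i) * x * S j = k%:A.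
Proof.
case=> c ->; rewrite mulr_sumr mulr_suml.
apply: (big_ind (fun y => exists k : C, y = k%:A)).
- by exists 0; rewrite scale0r.
- by move=> _ _ [k ->] [l ->]; exists (k + l); rewrite scalerDl.
move=> al _; rewrite mulr_sumr mulr_suml.
apply: (big_ind (fun y => exists k : C, y = k%:A)).
- by exists 0; rewrite scale0r.
- by move=> _ _ [k ->] [l ->]; exists (k + l); rewrite scalerDl.
move=> be _.
have w1 (a : 1.-tuple 'I_2) : exists m, word_isom S a = S m.
  by case/tupleP: a => m a; exists m; rewrite tuple0 /word_isom big_seq1.
case: (w1 al) => m ->; case: (w1 be) => n ->.
have d p q : exists e : C, star (S p) * S q = e%:A.
  case: (ord2_cases p) => ->; case: (ord2_cases q) => ->; rewrite cuntz_simp;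
  by [exists 1; rewrite scale1r|exists 0; rewrite scale0r].
case: (d i m) => e he; case: (d n j) => e' he'.
exists (c al be * (e * e')).
rewrite -scalerAr -scalerAl !mulrA he -!mulrA he'.
by rewrite mulr_algl -!scalerA.
Qed.

(** Expanding 1 on both sides turns x into a 2 x 2 matrix with scalar diagonal entries by
    [F21_compress]; the off-diagonal ones vanish by [D2_offdiag]. *)
Lemma D2_level1 (x : A) : D2_level S 1 x ->
  exists s t : C, x = s *: (S1 * star S1) + t *: (S2 * star S2).
Proof.
case=> Dx Fx; have [s hs] := F21_compress ord0 ord0 Fx.
have [t ht] := F21_compress ord_max ord_max Fx.
have w1 i : word_isom S [:: i] = S i by rewrite /word_isom big_seq1.
have h12 : star S1 * x * S2 = 0.
  by have := @D2_offdiag [:: ord_max] [:: ord0] x Dx; rewrite !w1 cuntz_simp; apply.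
have h21 : star S2 * x * S1 = 0.
  by have := @D2_offdiag [:: ord0] [:: ord_max] x Dx; rewrite !w1 cuntz_simp; apply.
exists s, t.
rewrite -[LHS]mul1r -[LHS]mulr1 -cuntz_sum1 !mulrDl !mulrDr.
rewrite -!mulrA !(mulrA (star _) x) !(mulrA (star _ * x)).
by rewrite hs ht h12 h21 !mul0r !mulr0 addr0 add0r !mulr_algl -!scalerAr.
Qed.

End Cuntz.


(** * The canonical shift and its action on D_2 *)

Section CanonicalShift.
Context {C : numClosedFieldType} {A : cstarAlgType C} (S : 'I_2 -> A).
Hypothesis hS : cuntz_relations S.

Lemma cuntz_orth i j : i != j -> star (S i) * S j = 0.
Proof.
by case: (ord2_cases i) => ->; case: (ord2_cases j) => ->;
  rewrite ?eqxx// ?(cuntz_orth12 hS)// (cuntz_orth21 hS).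
Qed.

Lemma canonical_shift1 : canonical_shift S 1 = 1.
Proof. by rewrite /canonical_shift sum_ord2 !mulr1 cuntz_sum1. Qed.

Lemma canonical_shift_lin k x y :
  canonical_shift S (k *: x + y) = k *: canonical_shift S x + canonical_shift S y.
Proof.
rewrite /canonical_shift scaler_sumr -big_split; apply: eq_bigr => i _ /=.
by rewrite mulrDr mulrDl -scalerAr -scalerAl.
Qed.

(** Only the i-th summand survives. This intertwining relation moves the shift past words. *)
Lemma canonical_shift_mulS x i : canonical_shift S x * S i = S i * x.
Proof.
rewrite /canonical_shift mulr_suml (bigD1 i)//= -mulrA cuntz_isometry// mulr1.
rewrite big1 ?addr0// => j ji.
by rewrite -mulrA cuntz_orth// mulr0.
Qed.

Lemma D2_canonical_shift_word (al : seq 'I_2) :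
  D2 S (canonical_shift S (word_isom S al * star (word_isom S al))).
Proof.
rewrite /canonical_shift sum_ord2 -!range_projection_cons.
by apply: cstar_subalgebraD (cstar_generated_subalgebra _) _ _;
  exact: D2_range_projection.
Qed.

(** The scalar l k^* is the matrix coefficient of u u^* between the orthogonal words S_2 S_j and S_1
    S_j. *)
Lemma D2_offdiag_coef k l j :
  let u := k *: (S ord0 * S j) + l *: (S ord_max * S j) in
  D2 S (u * star u) -> l * k^* = 0.
Proof.
move=> u Du.
have w2 i : word_isom S [:: i; j] = S i * S j.
  by rewrite /word_isom big_cons big_seq1.
have z i : star (S i * S j) * u = (if i == ord0 then k else l)%:A.
  rewrite /u mulrDr -!scalerAr starM -!mulrA.
  by case: (ord2_cases i) => ->; rewrite !(cuntz_simp hS) mulr0 scaler0 ?addr0 ?add0r.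
have zV : star u * (S ord0 * S j) = k^*%:A.
  by rewrite -[LHS]starK starM starK z starZ star1.
have E : star (S ord_max * S j) * (u * star u) * (S ord0 * S j) = (l * k^*)%:A.
  by rewrite [X in X * _]mulrA z -mulrA zV /= mulr_algl scalerA.
have := @D2_offdiag _ _ _ hS [:: ord0; j] [:: ord_max; j] _ Du.
rewrite !w2 E starM -mulrA (cuntz_cancel21 hS) mulr0 => /(_ erefl)/eqP.
by rewrite scaler_eq0 oner_eq0 orbF => /eqP.
Qed.

End CanonicalShift.

Lemma F2D (C : numClosedFieldType) (A : cstarAlgType C) (S : 'I_2 -> A) k x y :
  F2 S k x -> F2 S k y -> F2 S k (x + y).
Proof.
move=> [c ->] [c' ->]; exists (fun al be => c al be + c' al be).
rewrite -big_split; apply: eq_bigr => al _ /=.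
by rewrite -big_split; apply: eq_bigr => be _ /=; rewrite scalerDl.
Qed.

Lemma F2Z (C : numClosedFieldType) (A : cstarAlgType C) (S : 'I_2 -> A) k t x :
  F2 S k x -> F2 S k (t *: x).
Proof.
move=> [c ->]; exists (fun al be => t * c al be).
rewrite scaler_sumr; apply: eq_bigr => al _.
by rewrite scaler_sumr; apply: eq_bigr => be _; rewrite scalerA.
Qed.

(** Left multiplication by it sends the words 11, 12 to combinations of 11, 21 with matrix (a, b;
    -b^*, a^* ), and 21, 22 to combinations of 12, 22 with matrix (c, d; -d^*, c^* ). *)
Definition cuntz_twist (C : numClosedFieldType) (A : cstarAlgType C)
    (S : 'I_2 -> A) (a b c d : C) : A :=
  let S1 := S ord0 in let S2 := S ord_max in
    S1 * (a *: (S1 * star S1) + b *: (S1 * star S2)) * star S1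
  + S1 * (c *: (S2 * star S1) + d *: (S2 * star S2)) * star S2
  + S2 * (- b^* *: (S1 * star S1) + a^* *: (S1 * star S2)) * star S1
  + S2 * (- d^* *: (S2 * star S1) + c^* *: (S2 * star S2)) * star S2.

(** * The element w: action on words, unitarity, conjugation of the diagonal *)

Section Twist.
Context {C : numClosedFieldType} {A : cstarAlgType C} (S : 'I_2 -> A).
Hypothesis hS : cuntz_relations S.
Variables a b c d : C.
Local Notation S1 := (S ord0).
Local Notation S2 := (S ord_max).
Local Notation w := (cuntz_twist S a b c d).

(* Brings a polynomial in the S_i and S_i^* into a right-associated normal form. *)
Ltac cuntz_normalize :=
  rewrite ?(starD, starM, starZ, starK) ?(mulrDl, mulrDr);
  rewrite -?(scalerAl, scalerAr) -?mulrA ?(cuntz_simp hS);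
  rewrite ?(mulr0, mul0r, mulr1, scaler0, addr0, add0r).

Lemma twist11 : w * (S1 * S1) = a *: (S1 * S1) + - b^* *: (S2 * S1).
Proof. by rewrite /cuntz_twist/=; cuntz_normalize. Qed.
Lemma twist12 : w * (S1 * S2) = b *: (S1 * S1) + a^* *: (S2 * S1).
Proof. by rewrite /cuntz_twist/=; cuntz_normalize. Qed.
Lemma twist21 : w * (S2 * S1) = c *: (S1 * S2) + - d^* *: (S2 * S2).
Proof. by rewrite /cuntz_twist/=; cuntz_normalize. Qed.
Lemma twist22 : w * (S2 * S2) = d *: (S1 * S2) + c^* *: (S2 * S2).
Proof. by rewrite /cuntz_twist/=; cuntz_normalize. Qed.

Lemma twistV11 : star w * (S1 * S1) = a^* *: (S1 * S1) + b^* *: (S1 * S2).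
Proof. by rewrite /cuntz_twist/=; cuntz_normalize. Qed.
Lemma twistV21 : star w * (S2 * S1) = - b *: (S1 * S1) + a *: (S1 * S2).
Proof.
rewrite /cuntz_twist/=; cuntz_normalize.
have -> : (- b^*)^* = - b by rewrite rmorphN/= conjCK.
by rewrite conjCK.
Qed.
Lemma twistV12 : star w * (S1 * S2) = c^* *: (S2 * S1) + d^* *: (S2 * S2).
Proof. by rewrite /cuntz_twist/=; cuntz_normalize. Qed.
Lemma twistV22 : star w * (S2 * S2) = - d *: (S2 * S1) + c *: (S2 * S2).
Proof.
rewrite /cuntz_twist/=; cuntz_normalize.
have -> : (- d^*)^* = - d by rewrite rmorphN/= conjCK.
by rewrite conjCK.
Qed.

Lemma twist_word j m : exists k l,
  w * (S j * S m) = k *: (S1 * S j) + l *: (S2 * S j).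
Proof.
case: (ord2_cases j) => ->; case: (ord2_cases m) => ->.
- by rewrite twist11; do 2 eexists.
- by rewrite twist12; do 2 eexists.
- by rewrite twist21; do 2 eexists.
- by rewrite twist22; do 2 eexists.
Qed.

Lemma twist_F2 : F2 S 2 w.
Proof.
have E i j k l : F2 S 2 (S i * (S j * (star (S k) * star (S l)))).
  have := F2_word S [tuple i; j] [tuple l; k].
  by rewrite /word_isom !big_cons !big_nil !mulr1 starM -mulrA.
rewrite /cuntz_twist/=; cuntz_normalize.
by do ![apply: F2D | apply: F2Z]; exact: E.
Qed.

(** Compare both sides on S_j S_m: for j different from i both vanish, and for j = i both equal w
    S_i S_m x. *)
Lemma twist_shift i x :
  w * (S i * canonical_shift S x * star (S i)) =
  canonical_shift S (S i * x * star (S i)) * w.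
Proof.
apply: (eq_on_words hS) => j m.
have [k [l wE]] := twist_word j m.
rewrite -[RHS]mulrA wE mulrDr -!scalerAr.
rewrite !(mulrA (canonical_shift _ _)) !(canonical_shift_mulS hS).
have [ij|ij] := eqVneq i j; last first.
  rewrite -!mulrA (cuntz_orth hS ij) !mulr0 !scaler0 addr0.
  by rewrite (mulrA _ (S j)) (cuntz_orth hS ij) mul0r !mulr0.
rewrite -{j}ij in wE *.
rewrite -!mulrA (cuntz_cancel hS) (canonical_shift_mulS hS).
by rewrite 2!(mulrA _ _ x) wE mulrDl -!scalerAl -!mulrA (cuntz_isometry hS) mulr1.
Qed.

Hypotheses (hab : `|a| ^+ 2 + `|b| ^+ 2 = 1) (hcd : `|c| ^+ 2 + `|d| ^+ 2 = 1).

Let hab' : a * a^* + b * b^* = 1. Proof. by rewrite -!normCK. Qed.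
Let hcd' : c * c^* + d * d^* = 1. Proof. by rewrite -!normCK. Qed.

Lemma lincomb_first (X Y : A) (s t s' t' : C) : s + s' = 1 -> t + t' = 0 ->
  s *: X + t *: Y + (s' *: X + t' *: Y) = X.
Proof. by move=> h h'; rewrite addrACA -!scalerDl h h' scale1r scale0r addr0. Qed.

Lemma lincomb_second (X Y : A) (s t s' t' : C) : s + s' = 0 -> t + t' = 1 ->
  s *: X + t *: Y + (s' *: X + t' *: Y) = Y.
Proof. by move=> h h'; rewrite addrACA -!scalerDl h h' scale1r scale0r add0r. Qed.

Lemma twist_unitary : unitary w.
Proof.
split; apply: (eq_on_words hS) => i j; rewrite mul1r -mulrA;
  case: (ord2_cases i) => ->; case: (ord2_cases j) => ->;
  rewrite ?(twist11, twist12, twist21, twist22, twistV11, twistV12, twistV21, twistV22);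
  rewrite mulrDr -!scalerAr;
  rewrite ?(twist11, twist12, twist21, twist22, twistV11, twistV12, twistV21, twistV22);
  rewrite !scalerDr !scalerA;
  (* The word acted on returns with coefficient 1 by the normalization; its partner gets coefficient
     0 by cancellation. *)
  (apply: lincomb_first || apply: lincomb_second);
  by (rewrite -hab'; ring) || (rewrite -hcd'; ring) || ring.
Qed.

Lemma twist_conj_shift i x :
  w * (S i * canonical_shift S x * star (S i)) * star w =
  canonical_shift S (S i * x * star (S i)).
Proof. by rewrite twist_shift -mulrA twist_unitary.2 mulr1. Qed.

Lemma twist_cuntz_relations : cuntz_relations (fun i => w * S i).
Proof.
have [wV Vw] := twist_unitary; split=> [i|].
  by rewrite starM -mulrA (mulrA (star w)) wV mul1r cuntz_isometry.
have -> : 1 = w * (\sum_i S i * star (S i)) * star w by rewrite hS.2 mulr1 Vw.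
rewrite mulr_sumr mulr_suml.
by apply: eq_bigr => i _; rewrite starM !mulrA.
Qed.

(** Prefixing a letter i turns lam y = phi y into lam (S_i y S_i^* ) = w S_i phi(y) S_i^* w^*, which
    [twist_conj_shift] evaluates. *)
Lemma twist_endo_word lam al : is_cuntz_endo S w lam ->
  lam (word_isom S al * star (word_isom S al)) =
  canonical_shift S (word_isom S al * star (word_isom S al)).
Proof.
move=> [[_ [lam1 lamM] lams] lamS].
elim: al => [|i al IH].
  by rewrite /word_isom big_nil star1 mulr1 lam1 canonical_shift1.
rewrite range_projection_cons -twist_conj_shift -IH !lamM !lams !lamS starM.
by rewrite !mulrA.
Qed.

Lemma twist_conj_D2_level1 x : D2_level S 1 x -> w * x * star w = canonical_shift S x.
Proof.
move=> /(D2_level1 hS)[s [t ->]].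
have P i : w * (S i * star (S i)) * star w = canonical_shift S (S i * star (S i)).
  by have := twist_conj_shift i 1; rewrite (canonical_shift1 hS) mulr1.
have sZ y : canonical_shift S (t *: y) = t *: canonical_shift S y.
  rewrite /canonical_shift scaler_sumr; apply: eq_bigr => i _.
  by rewrite -scalerAr -scalerAl.
by rewrite canonical_shift_lin sZ -!P mulrDr mulrDl -!scalerAr -!scalerAl.
Qed.

Lemma twist_normalizer : normalizer (D2 S) w -> a * b = 0 /\ c * d = 0.
Proof.
case=> _ wD.
(* Conjugating the range projection of S_j S_1 by w gives u u^* with u = w S_j S_1, an element of
   D_2 by hypothesis. *)
have D j : D2 S (w * (S j * S ord0) * star (w * (S j * S ord0))).
  rewrite -[D2 S]wD; exists (S j * S ord0 * star (S j * S ord0)).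
    have := @D2_range_projection _ _ S [:: j; ord0].
    by rewrite /word_isom big_cons big_seq1.
  by rewrite [in RHS]starM !mulrA.
(* The coefficients obtained are -b^* a^* and -d^* c^*; they vanish exactly when ab and cd do. *)
have := D ord0; rewrite twist11 => /(D2_offdiag_coef hS)/eqP.
have := D ord_max; rewrite twist21 => /(D2_offdiag_coef hS)/eqP.
rewrite !mulf_eq0 !oppr_eq0 !conjC_eq0 => cd ab.
by split; apply/eqP; rewrite mulf_eq0 orbC.
Qed.

End Twist.

Theorem mainTheorem8 (R : realType) (A : cstarAlgType R[i]) (S : 'I_2 -> A)
    (hS : is_cuntz_algebra S) (a b c d : R[i])
    (hab : `|a| ^+ 2 + `|b| ^+ 2 = 1) (hcd : `|c| ^+ 2 + `|d| ^+ 2 = 1) :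
  let S1 := S ord0 in
  let S2 := S ord_max in
  let w : A :=
      S1 * (a *: (S1 * star S1) + b *: (S1 * star S2)) * star S1
    + S1 * (c *: (S2 * star S1) + d *: (S2 * star S2)) * star S2
    + S2 * (- b^* *: (S1 * star S1) + a^* *: (S1 * star S2)) * star S1
    + S2 * (- d^* *: (S2 * star S1) + c^* *: (S2 * star S2)) * star S2 in
  [/\ unitary w,
      F2 S 2 w,
      conj_by w (D2_level S 1) = canonical_shift S @` D2_level S 1,
      (exists! lam : A -> A, is_cuntz_endo S w lam) /\
      (forall lam : A -> A, is_cuntz_endo S w lam -> lam @` D2 S `<=` D2 S)
    & normalizer (D2 S) w -> a * b = 0 /\ c * d = 0].
Proof.
move=> S1 S2 w; have -> : w = cuntz_twist S a b c d by [].
case: hS => {S1 S2 w} rS genS univS; split.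
- exact: twist_unitary.
- exact: twist_F2.
- by apply: eq_imagel => x /(twist_conj_D2_level1 rS hab hcd).
- split.
    (* Universality, applied to the isometries w S_i, produces lambda_w. *)
    have [f fhom fS] := univS A _ (twist_cuntz_relations rS hab hcd).
    exists f; split=> // g [ghom gS]; apply/funext => x.
    have Gx : cstar_generated (range S) x by rewrite genS.
    apply: (Gx [set y | f y = g y]); split; first exact: equalizer_subalgebra.
    by move=> _ [i _ <-] /=; rewrite fS gS.
  move=> lam hlam _ [x Dx <-].
  apply: (Dx (lam @^-1` D2 S)); split.
    apply: preimage_subalgebra; first by case: hlam.
    exact: cstar_generated_subalgebra.
  move=> _ [al _ <-] /=.
  rewrite (twist_endo_word rS hab hcd)//; exact: D2_canonical_shift_word.
- exact: twist_normalizer.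
Qed.
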